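(* Let $s\ge 1$. An $s$-stage explicit Runge--Kutta method of order $s$, with coefficients $a_{ik}$, $0\le k<i\le s$ (where $a_{sj}=b_j$ are the weights), satisfies the RK-SSP condition if and only if all elements of the strictly lower-triangular part of $A_L$ are positive, i.e. $a_{ik}>0$ for all $0\le k<i\le s$.
   Context: An $s$-stage explicit Runge--Kutta scheme for an ODE system $u'=G(u)$ with time step $\tau$ and coefficients $a_{ik}$ ($0\le k<i\le s$) is $$v_0=u_n,\qquad v_i=u_n+\tau\sum_{j=0}^{i-1}a_{ij}G(v_j)\quad(1\le i\le s),\qquad u_{n+1}=v_s,$$ where the last row is $a_{sj}=b_j$, with $b_j$ the weights of the Butcher tableau. The order of the method is meant in the usual sense (agreement with the Taylor expansion of the exact solution, for all smooth ODE systems). The strictly lower-triangular matrix $A_L$ is the $(s+1)\times(s+1)$ matrix, with rows and columns indexed by $0,\dots,s$, whose entries below the diagonal are $a_{ik}$, $0\le k<i\le s$, all other entries being zero. Shu--Osher form: given numbers $\alpha_{ik}$ ($0\le k<i\le s$) with $\sum_{k=0}^{i-1}\alpha_{ik}=1$ for $1\le i\le s$, the scheme can be rewritten as $$v_0=u_n,\qquad v_i=\sum_{k=0}^{i-1}\bigl(\alpha_{ik}v_k+\tau\beta_{ik}G(v_k)\bigr)\quad(1\le i\le s),\qquad u_{n+1}=v_s,$$ where $$\beta_{ik}=a_{ik}-\sum_{j=k+1}^{i-1}\alpha_{ij}a_{jk},\qquad 0\le k\le i-1 .$$ The scheme satisfies the RK-SSP condition if there exist $\alpha_{ik}$ such that,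 with $\beta_{ik}$ given by $\beta_{ik}=a_{ik}-\sum_{j=k+1}^{i-1}\alpha_{ij}a_{jk}$ for $0\le k\le i-1$, $\sum_{k=0}^{i-1}\alpha_{ik}=1$ for $1\le i\le s$, and $\alpha_{ik}\ge 0$, $\beta_{ik}\ge 0$ for all $0\le k<i\le s$, and $\beta_{ik}=0$ whenever $\alpha_{ik}=0$. *)

(* Defs.v *)
From HB Require Import structures.
From mathcomp Require Import all_boot all_order all_algebra.
From mathcomp Require Import all_classical all_reals all_analysis.

Set Implicit Arguments.
Unset Strict Implicit.
Unset Printing Implicit Defensive.

Import Order.TTheory GRing.Theory Num.Theory.
Import numFieldNormedType.Exports.

Local Open Scope classical_set_scope.
Local Open Scope ring_scope.

(* Coefficient families are total functions [nat -> nat -> R]; only the values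
   [a i k] with [k < i <= s] are ever used. *)

Section RungeKutta.
Context {R : realType}.

Section Step.
Variables (d : nat) (a : nat -> nat -> R).
Variables (G : 'rV[R]_d -> 'rV[R]_d) (tau : R) (u : 'rV[R]_d).

(* The sequence v_0, ..., v_i; see [rk_stageE] for the defining recursion. *)
Fixpoint rk_stages (i : nat) : seq 'rV[R]_d :=
  if i is i'.+1 then
    let vs := rk_stages i' in
    rcons vs (u + tau *: \sum_(j < i'.+1) a i'.+1 j *: G (nth 0 vs j))
  else [:: u].

Definition rk_stage (i : nat) : 'rV[R]_d := nth 0 (rk_stages i) i.

Lemma size_rk_stages i : size (rk_stages i) = i.+1.
Proof. by elim: i => //= i IH; rewrite size_rcons IH. Qed.

Lemma nth_rk_stages i j : (j <= i)%N -> nth 0 (rk_stages i) j = rk_stage j.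
Proof.
elim: i => [|i IH]; first by rewrite leqn0 => /eqP ->.
rewrite leq_eqVlt => /predU1P[-> //|ji].
by rewrite /= nth_rcons size_rk_stages ji IH.
Qed.

Lemma rk_stage0 : rk_stage 0 = u.
Proof. by []. Qed.

Lemma rk_stageE i :
  rk_stage i = u + tau *: \sum_(j < i) a i j *: G (rk_stage j).
Proof.
case: i => [|i]; first by rewrite big_ord0 scaler0 addr0.
rewrite {1}/rk_stage /= nth_rcons size_rk_stages ltnn eqxx.
congr (_ + _ *: _); apply: eq_bigr => j _.
by rewrite nth_rk_stages // -ltnS.
Qed.

End Step.

Fixpoint Ck d (n : nat) (G : 'rV[R]_d -> 'rV[R]_d) : Prop :=
  if n is n'.+1 then
    (forall x, differentiable G x) /\ (forall v, Ck n' (fun x => 'D_v G x))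
  else continuous G.

Definition smooth d (G : 'rV[R]_d -> 'rV[R]_d) : Prop := forall n, Ck n G.

Definition local_solution d (G : 'rV[R]_d -> 'rV[R]_d) (u0 : 'rV[R]_d)
    (u : R -> 'rV[R]_d) : Prop :=
  u 0 = u0 /\ \forall t \near 0, is_derive t (1 : R) u (G (u t)).

Definition taylor_poly d (u : R -> 'rV[R]_d) (p : nat) (tau : R) : 'rV[R]_d :=
  \sum_(k < p.+1) (tau ^+ k / k`!%:R) *: derive1n k u 0.

(* As is customary, "order p" means order at least p: the result of one step
   agrees with the Taylor expansion of the exact solution up to and including
   the terms in tau ^ p. *)
Definition rk_order (s : nat) (a : nat -> nat -> R) (p : nat) : Prop :=
  forall (d : nat) (G : 'rV[R]_d -> 'rV[R]_d) (u0 : 'rV[R]_d)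
    (u : R -> 'rV[R]_d),
    smooth G -> local_solution G u0 u ->
    (fun tau => rk_stage a G tau u0 s - taylor_poly u p tau)
      =O_ (0^'+) (fun tau : R => tau ^+ p.+1).

Definition shu_osher_beta (a alpha : nat -> nat -> R) (i k : nat) : R :=
  a i k - \sum_(k.+1 <= j < i) alpha i j * a j k.

Definition rk_ssp (s : nat) (a : nat -> nat -> R) : Prop :=
  exists alpha : nat -> nat -> R,
    [/\ forall i, (1 <= i <= s)%N -> \sum_(k < i) alpha i k = 1,
        forall i k, (k < i <= s)%N -> 0 <= alpha i k,
        forall i k, (k < i <= s)%N -> 0 <= shu_osher_beta a alpha i k
      & forall i k, (k < i <= s)%N ->
          alpha i k = 0 -> shu_osher_beta a alpha i k = 0].

Definition lower_mx (s : nat) (a : nat -> nat -> R) : 'M[R]_s.+1 :=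
  \matrix_(i, k) if (k < i)%N then a i k else 0.

End RungeKutta.

(* Main.v *)
Require Import Defs.
From mathcomp Require Import all_boot all_order all_algebra.
From mathcomp Require Import all_classical all_reals all_analysis.
Import Order.TTheory GRing.Theory Num.Theory.
Import numFieldNormedType.Exports.
Local Open Scope classical_set_scope.
Local Open Scope ring_scope.

(* Applied to u' = u, the scheme yields p(tau) u with p a polynomial of degree
   at most s whose coefficient of tau^s is the product of the subdiagonal
   entries a_(i,i-1), while the exact solution is exp(tau) u. Order s forces
   this product to be 1/s!, so no subdiagonal entry vanishes. Under RK-SSP,
   beta_(i,i-1) = a_(i,i-1), hence a_(i,i-1) > 0 and alpha_(i,i-1) > 0; then
   a_ik >= alpha_(i,i-1) a_(i-1,k) propagates positivity down the rows.
   Conversely, if all a_ik are positive, putting a small weight on every v_k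
   with k > 0 and the remaining weight on v_0 keeps every beta_ik positive. *)

(** Letting [t] tend to [0] from the right kills the constant coefficient; dividing [q] by ['X] then
    lowers both the size and the exponent by one, which allows induction on [n]. *)
Lemma poly_bigO_eq0 (R : realType) (n : nat) (q : {poly R}) (C : R) :
  (size q <= n)%N ->
  (\forall t \near 0^'+, `|q.[t]| <= C * t ^+ n) -> q = 0.
Proof.
elim: n q => [|n IHn] q szq qO.
  by apply/eqP; rewrite -size_poly_leq0.
have q0 : q.[0] = 0.
  have qcvg : `|q.[t]| @[t --> 0^'+] --> `|q.[0]|.
    apply: cvg_at_right_filter; apply: cvg_norm; exact: continuous_horner.
  (* The bound is written as a polynomial so that its limit at [0] also comes from continuity of
     evaluation. *)
  have Ccvg : (C *: 'X^(n.+1)).[t] @[t --> 0^'+] --> (C *: 'X^(n.+1)).[0].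
    apply: cvg_at_right_filter; exact: continuous_horner.
  have : `|q.[0]| <= (C *: 'X^(n.+1)).[0].
    apply: ler_cvg_to qcvg Ccvg _.
    by apply: filterS qO => t; rewrite !hornerE.
  by rewrite !hornerE expr0n mulr0 normr_le0 => /eqP.
have /factor_theorem[r qE] : root q 0 by apply/rootP.
move: qE; rewrite subr0 => qE.
have [r0|r0] := eqVneq r 0; first by rewrite qE r0 mul0r.
suff r_eq0 : r = 0 by rewrite r_eq0 eqxx in r0.
apply: IHn; first by move: szq; rewrite qE size_mulX.
near=> t.
have t0 : 0 < t by near: t; exact: nbhs_right_gt.
have : `|q.[t]| <= C * t ^+ n.+1 by near: t.
by rewrite qE !hornerE normrM (gtr0_norm t0) exprSr mulrA ler_pM2r.
Unshelve. all: by end_near. Qed.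

(** For [G = id] the recursion for the stages becomes [p_i = 1 + 'X * \sum_(j < i) a i j *: p_j]. *)
Lemma rk_stage_id (R : realType) (d : nat) (a : nat -> nat -> R) (i : nat) :
  exists p : {poly R},
    [/\ forall tau (v : 'rV[R]_d), rk_stage a id tau v i = p.[tau] *: v,
        (size p <= i.+1)%N & p`_i = \prod_(j < i) a j.+1 j].
Proof.
elim/ltn_ind: i => i IHi.
have /choice[p pP] : forall j : 'I_i, exists p : {poly R},
    [/\ forall tau (v : 'rV[R]_d), rk_stage a id tau v j = p.[tau] *: v,
        (size p <= j.+1)%N & p`_j = \prod_(l < j) a l.+1 l].
  by move=> j; exact: IHi.
exists (1 + (\sum_(j < i) a i j *: p j) * 'X); split => [tau v||].
- rewrite rk_stageE !hornerE horner_sum mulrC scalerDl scale1r -scalerA.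
  rewrite scaler_suml; congr (_ + _ *: _); apply: eq_bigr => j _.
  by rewrite hornerZ -scalerA; have [-> _ _] := pP j.
- apply: (leq_trans (size_polyD _ _)); rewrite size_poly1 geq_max /=.
  apply: (leq_trans (size_polyMleq _ _)); rewrite size_polyX addn2 /= ltnS.
  apply: (leq_trans (size_sum _ _ _)); apply/bigmax_leqP => j _.
  apply: leq_trans (size_scale_leq _ _) _; have [_ szp _] := pP j.
  exact: leq_trans szp (ltn_ord j).
- rewrite coefD coefMX coef1; case: i IHi p pP => [|i] _ p pP /=.
    by rewrite big_ord0 addr0.
  (* Only the last summand can reach this degree; the earlier ones are too short and contribute the
     default coefficient [0]. *)
  rewrite add0r coef_sum big_ord_recr big1 /= => [|j _].
    have [_ _ /= pi] := pP ord_max.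
    by rewrite add0r coefZ pi [RHS]big_ord_recr mulrC.
  rewrite coefZ nth_default ?mulr0//=.
  by have [_ szp _] := pP (widen_ord (leqnSn i) j); exact: leq_trans szp (ltn_ord j).
Qed.

Lemma Ck_cst (R : realType) (d n : nat) (c : 'rV[R]_d) : Ck n (fun=> c).
Proof.
elim: n c => [|n IHn] c /=; first exact: cst_continuous.
split=> [x|v]; first exact: differentiable_cst.
by under eq_fun do rewrite derive_cst; exact: IHn.
Qed.

Lemma smooth_id (R : realType) (d : nat) : smooth (@id 'rV[R]_d).
Proof.
case=> [|n] /=; first by move=> x.
split=> [x|v]; first exact: ex_diff.
by under eq_fun do rewrite derive_id; exact: Ck_cst.
Qed.

Lemma is_derive_expRZ (R : realType) (V : normedModType R) (v : V) (t : R) :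
  is_derive t (1 : R) (fun t => expR t *: v) (expR t *: v).
Proof.
have de : differentiable (@expR R) t by apply/derivable1_diffP.
apply: DeriveDef; first by apply: diff_derivable; exact: differentiableZl.
rewrite deriveE; last exact: differentiableZl.
by rewrite diffZl// -deriveE// derive_val.
Qed.

Lemma derive1n_expRZ (R : realType) (V : normedModType R) (v : V) (k : nat) :
  derive1n k (fun t : R => expR t *: v) = fun t => expR t *: v.
Proof.
elim: k => // k IHk; rewrite derive1nS IHk; apply/funext => t.
by rewrite derive1E; have [_ ->] := is_derive_expRZ R V v t.
Qed.

Lemma rk_order_prod (R : realType) (s : nat) (a : nat -> nat -> R) :
  rk_order s a s -> \prod_(j < s) a j.+1 j = s`!%:R^-1.
Proof.
pose v : 'rV[R]_1 := const_mx 1.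
have v0 : 0 < `|v|.
  rewrite normr_gt0; apply/eqP => /matrixP/(_ 0 0).
  by rewrite !mxE => /eqP; rewrite oner_eq0.
have [p [pE szp <-]] := rk_stage_id R 1 a s.
(* The subtracted polynomial is the exponential series truncated at degree [s], so [q] measures the
   error of one step. *)
pose q := p - \poly_(k < s.+1) k`!%:R^-1.
have sol : local_solution id v (fun t => expR t *: v).
  split; first by rewrite expR0 scale1r.
  by near=> t; exact: is_derive_expRZ.
move=> /(_ _ _ _ _ (smooth_id R 1) sol)/eqO_exP[C _ qO].
have : q = 0.
  (* The error is [q.[t] *: v]; dividing by the norm of [v] leaves a scalar bound on [q]. *)
  apply: (@poly_bigO_eq0 _ s.+1 _ (C / `|v|)).
    rewrite (leq_trans (size_polyD _ _))// geq_max szp size_polyN.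
    exact: size_poly.
  near=> t.
  have t0 : 0 < t by near: t; exact: nbhs_right_gt.
  have qtE : rk_stage a id t v s - taylor_poly (fun t => expR t *: v) s t
             = q.[t] *: v.
    rewrite pE hornerD hornerN scalerBl horner_poly scaler_suml; congr (_ - _).
    by apply: eq_bigr => k _; rewrite derive1n_expRZ expR0 scale1r mulrC.
  rewrite mulrAC ler_pdivlMr// -normrZ -qtE -[t ^+ _]gtr0_norm ?exprn_gt0//.
  by near: t.
move=> /(congr1 (fun r : {poly R} => r`_s))/eqP.
by rewrite coefB coef0 coef_poly ltnSn subr_eq0 => /eqP.
Unshelve. all: by end_near. Qed.

(** Used to choose one weight [e] meeting finitely many smallness conditions. In the proof,
    [|x| + 1] is a positive divisor whatever the value of [x]. *)
Lemma near0_mul_lt (R : realType) (x y : R) :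
  0 < y -> \forall e \near 0^'+, e * x < y.
Proof.
move=> y0; have x0 : 0 < `|x| + 1 by rewrite ltr_wpDl.
near=> e.
have e0 : 0 < e by near: e; exact: nbhs_right_gt.
apply: (@le_lt_trans _ _ (e * (`|x| + 1))).
  by rewrite ler_pM2l// (le_trans (ler_norm x))// lerDl.
by rewrite -ltr_pdivlMr//; near: e; apply: nbhs_right_lt; rewrite divr_gt0.
Unshelve. all: by end_near. Qed.

Lemma rk_ssp_gt0 (R : realType) (s : nat) (a : nat -> nat -> R) :
  (forall j, (j < s)%N -> a j.+1 j != 0) -> rk_ssp s a ->
  forall i k, (k < i <= s)%N -> 0 < a i k.
Proof.
move=> a_neq0 [alpha [_ alpha_ge0 beta_ge0 beta0]].
elim/ltn_ind=> -[|i] IHi k /andP[ki lis] //.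
have betaE : shu_osher_beta a alpha i.+1 i = a i.+1 i.
  by rewrite /shu_osher_beta big_geq ?subr0.
have ii : (i < i.+1 <= s)%N by rewrite ltnSn.
have a_gt0 : 0 < a i.+1 i.
  by rewrite lt_neqAle eq_sym a_neq0//= -betaE beta_ge0.
move: ki; rewrite ltnS leq_eqVlt => /predU1P[-> //|ki].
have alpha_gt0 : 0 < alpha i.+1 i.
  rewrite lt_neqAle alpha_ge0// andbT eq_sym; apply/eqP => /(beta0 _ _ ii).
  by rewrite betaE => /eqP; rewrite gt_eqF.
have : 0 <= shu_osher_beta a alpha i.+1 k by rewrite beta_ge0// ltnW.
(* The last term of the sum, [j = i], is strictly positive; the others are nonnegative by induction
   on the row. *)
rewrite subr_ge0; apply: lt_le_trans; rewrite big_nat_recr//=.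
have a_jk_gt0 j : (k < j < i.+1)%N -> 0 < a j k.
  by move=> /andP[kj ji]; apply: IHi => //; rewrite kj (leq_trans (ltnW ji)).
apply: ltr_wpDl; last by rewrite mulr_gt0// a_jk_gt0// ki ltnSn.
rewrite big_nat_cond; apply: sumr_ge0 => j; rewrite andbT => /andP[kj ji].
apply: mulr_ge0; first by rewrite alpha_ge0// ltnS (ltnW ji).
by rewrite ltW// a_jk_gt0// kj ltnS (ltnW ji).
Qed.

Lemma gt0_rk_ssp (R : realType) (s : nat) (a : nat -> nat -> R) :
  (forall i k, (k < i <= s)%N -> 0 < a i k) -> rk_ssp s a.
Proof.
move=> a_gt0.
have : \forall e \near (0 : R)^'+, [/\ 0 < e, e * s%:R < 1 &
    forall i k : 'I_s.+1, (k < i)%N -> e * \sum_(k.+1 <= j < i) a j k < a i k].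
  near=> e; split.
  - by near: e; exact: nbhs_right_gt.
  - by near: e; exact: near0_mul_lt.
  - near: e; apply: filter_forall => i; apply: filter_forall => k.
    have [ki|ki] := ltnP k i; last by apply: nearW.
    have aik : 0 < a i k by apply: a_gt0; rewrite ki -ltnS ltn_ord.
    by apply: filterS (near0_mul_lt _ _ _ aik) => e + _; exact.
move=> /filter_ex[e [e0 es ea]].
(* Row [i] has [i.-1] indices [k > 0], each of weight [e]; [v_0] takes the rest, so that the row
   sums to 1. The condition [e * s%:R < 1] keeps that rest positive. *)
pose alpha i k : R := if k is 0 then 1 - e * i.-1%:R else e.
have alpha_gt0 i k : (k < i <= s)%N -> 0 < alpha i k.
  case: k => [|k] //= /andP[i0 lis]; rewrite subr_gt0.
  apply: le_lt_trans es; rewrite ler_pM2l// ler_nat.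
  exact: leq_trans (leq_pred _) lis.
have beta_gt0 i k : (k < i <= s)%N -> 0 < shu_osher_beta a alpha i k.
  move=> /andP[ki lis]; rewrite subr_gt0.
  have lks : (k < s.+1)%N by rewrite (leq_trans ki)// leqW.
  have := ea (Ordinal (lis : (i < s.+1)%N)) (Ordinal lks) ki.
  (* The sum in [shu_osher_beta] starts at [k.+1], so it never meets the special weight of [v_0]. *)
  rewrite mulr_sumr; congr (_ < _).
  by apply: eq_big_nat => -[].
exists alpha; split=> [[|i]//= _|i k /alpha_gt0/ltW//|i k /beta_gt0/ltW//|i k].
  by rewrite big_ord_recl /= sumr_const card_ord mulr_natr subrK.
by move=> /alpha_gt0 /gt_eqF/eqP.
Unshelve. all: by end_near. Qed.

Theorem proposition4 (R : realType) (s : nat) (a : nat -> nat -> R)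
  (hs : (1 <= s)%N) (ha : rk_order s a s) :
  rk_ssp s a <->
  (forall i k : 'I_s.+1, (k < i)%N -> 0 < lower_mx s a i k).
Proof.
split=> [ssp i k ki|mx_gt0].
  rewrite mxE ki; apply: (rk_ssp_gt0 _ _ _ _ ssp); last by rewrite ki -ltnS ltn_ord.
  have : \prod_(j < s) a j.+1 j != 0.
    by rewrite rk_order_prod// invr_neq0// pnatr_eq0 -lt0n fact_gt0.
  by move=> /prodf_neq0 a_neq0 j js; exact: (a_neq0 (Ordinal js)).
apply: gt0_rk_ssp => i k /andP[ki lis].
have lks : (k < s.+1)%N by rewrite (leq_trans ki)// leqW.
have := mx_gt0 (Ordinal (lis : (i < s.+1)%N)) (Ordinal lks) ki.
by rewrite mxE /= ki.
Qed.
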